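(* Let $d,k$ be positive integers. Let $Q$ be a discrete probability measure on $\mathbb{R}^d$ whose support contains at most $k$ points. Let $H_1,\dots,H_{k+1}$ be linear subspaces of $\mathbb{R}^d$ such that $H_i^\perp\cap H_j^\perp=\{0\}$ whenever $i\neq j$. Then, for every Borel probability measure $P$ on $\mathbb{R}^d$, we have $$d_{TV}(P,Q)\le \sum_{j=1}^{k+1} d_{TV}(P_{H_j},Q_{H_j}).$$
   Context: For probability measures $P,Q$ on a measurable space $(E,\mathcal{A})$, the total variation distance is $d_{TV}(P,Q):=\sup_{A\in\mathcal{A}}|P(A)-Q(A)|$. For a linear subspace $H$ of $\mathbb{R}^d$, $H^\perp$ denotes its orthogonal complement and $\pi_H:\mathbb{R}^d\to H$ the orthogonal projection onto $H$. For a Borel probability measure $P$ on $\mathbb{R}^d$, its projection $P_H$ onto $H$ is the Borel probability measure on $H$ given by $P_H(B):=P(\pi_H^{-1}(B))$ for Borel $B\subset H$. $\mathbb{R}^d$ and $H$ carry their Borel $\sigma$-algebras. *)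

(* Defs.v *)
From HB Require Import structures.
From mathcomp Require Import all_boot all_order all_algebra.
From mathcomp Require Import all_classical all_reals all_analysis.

Set Implicit Arguments.
Unset Strict Implicit.
Unset Printing Implicit Defensive.

Import Order.TTheory GRing.Theory Num.Theory.
Import numFieldNormedType.Exports.

Local Open Scope classical_set_scope.
Local Open Scope ring_scope.

Notation borel T := (g_sigma_algebraType (@open T)).

Section total_variation.
Local Open Scope ereal_scope.

(* The supremum is taken in \bar R, where it always exists; its value is in
   [0, 1]. *)
Definition dTV d (T : measurableType d) (R : realType)
    (P Q : probability T R) : \bar R :=
  ereal_sup [set `|P A - Q A| | A in measurable].

End total_variation.

Section discrete_measure.
Local Open Scope ereal_scope.
Context (R : realType) (T : ptopologicalType).
Implicit Type P : probability (borel T) R.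

(* On R^d countable sets are Borel; here measurability is required so that
   P S is meaningful on an arbitrary space. *)
Definition discrete_probability P :=
  exists S : set (borel T), [/\ countable S, measurable S & P S = 1].

Definition msupport P : set T :=
  [set x | forall U : set T, open U -> U x -> 0 < P U].

End discrete_measure.

Section dot_product.
Context (R : realType) (n : nat).

Definition dotp (u v : 'rV[R]_n) : R := \sum_(i < n) u ord0 i * v ord0 i.

Fact dotp_bilinear :
  bilinear_for
    (GRing.Scale.Law.clone _ _ ( *%R ) _)
    (GRing.Scale.Law.clone _ _ (idfun \; *%R) _) dotp.
Proof.
split=> [w|w] a u v; rewrite /dotp /= mulr_sumr -big_split /=;
  apply: eq_bigr => i _; rewrite !mxE.
- by rewrite mulrDl mulrA.
- by rewrite mulrDr mulrCA.
Qed.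

HB.instance Definition _ := bilinear_isBilinear.Build R _ _ _
  (GRing.Scale.Law.clone _ _ ( *%R ) _)
  (GRing.Scale.Law.clone _ _ (idfun \; *%R) _) dotp dotp_bilinear.

Fact dotp_sym u v : dotp u v = (-1) ^+ false * idfun (dotp v u).
Proof.
by rewrite expr0 mul1r; apply: eq_bigr => i _; rewrite mulrC.
Qed.

HB.instance Definition _ := @isHermitianSesquilinear.Build _ _ _ _ _ dotp_sym.

Definition orthocompl (H : {vspace 'rV[R]_n}) : {vspace 'rV[R]_n} :=
  orthov (@dotp) H.

Lemma capv_orthocompl (H : {vspace 'rV[R]_n}) : (H :&: orthocompl H = 0)%VS.
Proof.
apply/eqP; rewrite -subv0; apply/subvP => x; rewrite memv_cap memv0.
case/andP => xH /mem_orthovP/(_ _ xH)/eqP.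
rewrite /dotp psumr_eq0 => [/allP x0|i _]; last by rewrite -expr2 sqr_ge0.
apply/eqP/rowP => i; rewrite mxE; apply/eqP.
by have := x0 i (mem_index_enum _); rewrite /= -expr2 sqrf_eq0.
Qed.

Lemma addv_orthocompl (H : {vspace 'rV[R]_n}) :
  (H + orthocompl H = fullv)%VS.
Proof.
apply/eqP; rewrite eqEdim subvf dimv_disjoint_sum ?capv_orthocompl//=.
pose g (x : 'rV[R]_n) : 'rV[R]_(\dim H) := \row_i dotp x (vbasis H)`_i.
have g_lin : linear g.
  by move=> a x y; apply/rowP => i; rewrite !mxE linearPl.
pose glM := GRing.isLinear.Build _ _ _ _ g g_lin.
pose gl : {linear 'rV[R]_n -> 'rV[R]_(\dim H)} := HB.pack g glM.
have kerP : (lker (linfun gl) <= orthocompl H)%VS.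
  apply/subvP => x; rewrite memv_ker lfunE /= => /eqP/rowP gx0.
  apply/mem_orthovP => y /coord_vbasis ->; rewrite linear_sumr big1// => i _.
  by rewrite linearZr /=; have := gx0 i; rewrite !mxE => ->; rewrite mulr0.
have := limg_ker_dim (linfun gl) fullv; rewrite capfv => <-.
rewrite addnC leq_add ?dimvS//.
by rewrite (leq_trans (dimvS (subvf _)))// dimvf /dim /= mul1n.
Qed.

End dot_product.


(* A linear subspace, seen as the type [subvs_of H], carries the subspace
   topology. *)
HB.instance Definition _ (R : realType) (n : nat) (H : {vspace 'rV[R]_n}) :=
  isPointed.Build (subvs_of H) 0.
HB.instance Definition _ (R : realType) (n : nat) (H : {vspace 'rV[R]_n}) :=
  Topological.copy (subvs_of H) (initial_topology (@vsval _ _ H)).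

Section projection.
Context (R : realType) (n : nat) (H : {vspace 'rV[R]_n}).

Definition orthproj (x : borel 'rV[R]_n) : borel (subvs_of H) :=
  Subvs (memv_pi H (orthocompl H) x).

Lemma orthproj_continuous :
  continuous (orthproj : 'rV[R]_n -> subvs_of H).
Proof.
apply/continuousP => _ [A oA <-].
pose f := daddv_pi H (orthocompl H).
suff /continuousP/(_ _ oA) : continuous f by [].
move=> x.
have fE : f = (fun y => \sum_(i < n) y ord0 i *: f (delta_mx ord0 i)) :> (_ -> _).
  apply/funext => y; rewrite {1}[y]row_sum_delta linear_sum.
  by apply: eq_bigr => i _; rewrite linearZ.
rewrite fE; move: x; apply: continuous_big => [|i _].
  exact: add_continuous.
move=> x; apply: continuousZr_tmp; exact: coord_continuous.
Qed.

Lemma measurable_orthproj : measurable_fun setT orthproj.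
Proof.
apply: (@measurability _ _ _ _ setT orthproj (@open (subvs_of H))) => //.
move=> _ [B oB <-]; rewrite setTI; apply: sub_sigma_algebra.
by move/continuousP : orthproj_continuous; exact.
Qed.

HB.instance Definition _ :=
  isMeasurableFun.Build _ _ _ _ orthproj measurable_orthproj.

Definition projection (P : probability (borel 'rV[R]_n) R) :
    probability (borel (subvs_of H)) R :=
  distribution P orthproj.

Lemma orthproj_id (u : subvs_of H) : orthproj (vsval u) = u.
Proof.
by apply/val_inj; rewrite /= daddv_pi_id ?capv_orthocompl//; exact: subvsP.
Qed.

Lemma orthproj_ortho (x : 'rV[R]_n) : x - vsval (orthproj x) \in orthocompl H.
Proof.
rewrite /= -{1}(@daddv_pi_add _ _ H (orthocompl H) x) ?capv_orthocompl//.
  by rewrite addrC addKr memv_pi.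
by rewrite addv_orthocompl memvf.
Qed.

End projection.

(* Main.v *)
Require Import Defs.
From HB Require Import structures.
From mathcomp Require Import all_boot all_order all_algebra.
From mathcomp Require Import all_classical all_reals all_analysis.
From mathcomp Require Import ring.

Set Implicit Arguments.
Unset Strict Implicit.
Unset Printing Implicit Defensive.

Import Order.TTheory GRing.Theory Num.Theory.
Import numFieldNormedType.Exports.

Local Open Scope classical_set_scope.
Local Open Scope ring_scope.

(** For every point z, one of the k + 1 projections separates z from every atom
    of Q other than z itself.  Indeed, if an atom x <> z had the same image as
    z in both H_i and H_j, then x - z would lie in the intersection of the
    orthogonal complements of H_i and H_j, which is zero; so different
    directions confuse z with different atoms, and there are at most k atoms.
    Let J z be a separating direction ([separating_index]).

    Let A be the set of atoms and G a Borel set.  For each direction j, take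
    the cylinder F_j of the points whose projection to H_j differs from those
    of all atoms other than the atoms x of G with J x = j.
    Then G is covered by the F_j, since z in G belongs to F_(J z); and the
    traces of the F_j on A are pairwise disjoint subsets of G, since the
    trace of F_j only has atoms x with J x = j ([exists_cylinder_cover]).
    As Q is carried by A, the union bound for P and additivity for Q give
      P G - Q G <= \sum_j (P F_j - Q F_j),
    and every term on the right is at most the total variation distance of
    the projections to H_j, because F_j is the preimage of a cofinite, hence
    Borel, subset of H_j.  The bound on Q G - P G is the same statement for
    the complement of G.

    The set A is the topological support of Q: it is finite by assumption, and
    it carries Q because its complement meets the countable carrier in points
    of mass zero. *)

(** * Cylinders adapted to a finite set *)

(** If no index worked, choosing in each direction a point of [s] confused with
    [z] would embed the [k.+1] directions into [s]. *)
Lemma separating_index (k : nat) (T : eqType) (U : 'I_k.+1 -> Type)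
    (f : forall j, T -> U j) (s : seq T) :
    (size s <= k)%N ->
    (forall i j x y, i != j -> f i x = f i y -> f j x = f j y -> x = y) ->
  forall z, exists j, forall x, x \in s -> f j x = f j z -> x = z.
Proof.
move=> sk f_sep z; apply: contrapT => /forallNP nosep.
have /choice[g gP] j : exists x, [/\ x \in s, f j x = f j z & x <> z].
  apply: contrapT => /forallNP nox; apply: (nosep j) => x xs fx.
  by apply: contrapT => xz; apply: (nox x).
have g_inj : injective g.
  move=> i j gij; apply/eqP; apply: contrapT => /negP ij.
  have [_ fi gz] := gP i; have [_ fj _] := gP j.
  by apply: gz; apply: (f_sep i j) => //; rewrite gij.
suff : (size (codom g) <= size s)%N.
  by rewrite size_codom card_ord leqNgt ltnS sk.
apply: uniq_leq_size; first by rewrite map_inj_uniq ?enum_uniq.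
by move=> _ /codomP[j ->]; have [] := gP j.
Qed.

(** The preimages of the sets [V j] cover [G] although their traces on [A] are
    small enough to fit disjointly in it. *)
Lemma exists_cylinder_cover (T I : Type) (U : I -> Type)
    (f : forall j, T -> U j) (A G : set T) :
    finite_set A ->
    (forall z, exists j, forall x, A x -> f j x = f j z -> x = z) ->
  exists V : forall j, set (U j),
    [/\ forall j, finite_set (~` V j),
        G `<=` \bigcup_j (f j @^-1` V j),
        forall j, A `&` f j @^-1` V j `<=` G &
        trivIset setT (fun j => A `&` f j @^-1` V j)].
Proof.
move=> finA /choice[J JP].
exists (fun j => ~` (f j @` (A `\` [set x | G x /\ J x = j]))).
have trace j x : A x -> (~` (f j @` (A `\` [set x | G x /\ J x = j]))) (f j x) ->
    G x /\ J x = j.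
  by move=> Ax Vx; apply: contrapT => Gx; apply: Vx; exists x.
split => [j|z Gz|j x [Ax /(trace _ _ Ax)[]]//|i j _ _ [x [[Ax Vi] [_ Vj]]]].
- by rewrite setCK; apply/finite_image/finite_setD.
- exists (J z) => // -[x [Ax nGx] fxz]; apply: nGx.
  by rewrite /= (JP z x Ax fxz).
- by have [_ <-] := trace _ _ Ax Vi; have [_ <-] := trace _ _ Ax Vj.
Qed.

(** * Total variation *)

Section total_variation.
Local Open Scope ereal_scope.
Context d (T : measurableType d) (R : realType).
Implicit Types P Q : probability T R.

Lemma probability_setC_sub P Q (B : set T) : measurable B ->
  P (~` B) - Q (~` B) = Q B - P B.
Proof.
move=> mB; rewrite !probability_setC//.
rewrite -(fineK (fin_num_measure P _ mB)) -(fineK (fin_num_measure Q _ mB)).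
by rewrite -!EFinB; congr EFin; ring.
Qed.

Lemma probability_sub_le_dTV P Q (B : set T) : measurable B ->
  P B - Q B <= dTV P Q.
Proof.
move=> mB; apply: le_trans (lee_abs _) _.
by apply: ereal_sup_ubound; exists B.
Qed.

(** Complementation exchanges the two signs of [P B - Q B]. *)
Lemma dTV_le P Q (r : \bar R) :
  (forall B, measurable B -> P B - Q B <= r) -> dTV P Q <= r.
Proof.
move=> PQr; apply: ge_ereal_sup => _ [B mB <-].
have [PQ0|PQ0] := leP 0 (P B - Q B).
  by rewrite gee0_abs// PQr.
rewrite lte0_abs// fin_num_oppeB ?fin_num_measure// addeC.
by rewrite -probability_setC_sub// PQr//; exact: measurableC.
Qed.

End total_variation.

(** * Sets of full measure *)

Lemma negligible_countable d (T : measurableType d) (R : realType)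
    (mu : {measure set T -> \bar R}) (A : set T) :
  countable A -> (forall x, A x -> mu.-negligible [set x]) ->
  mu.-negligible A.
Proof.
move=> /countable_injP[f f_inj] A0.
have -> : A = \bigcup_n (A `&` f @^-1` [set n]).
  by rewrite eqEsubset; split => [x Ax|x [n _ []]//]; exists (f x).
apply: negligible_bigcup => n.
have [->|/set0P[x [Ax fx]]] := eqVneq (A `&` f @^-1` [set n]) set0.
  exact: negligible_set0.
apply: negligibleS (A0 x Ax) => y [Ay fy].
by apply: f_inj; rewrite ?inE//; exact: etrans fy (esym fx).
Qed.

(** In general the support of a measure may fail to carry it; here only its
    trace on a countable set matters, and a point outside the support has mass
    zero, being contained in a null open set. *)
Lemma msupport_full (R : realType) (T : ptopologicalType)
    (Q : probability (borel T) R) :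
    discrete_probability Q -> measurable (msupport Q : set (borel T)) ->
  Q (~` msupport Q) = 0%E.
Proof.
set A := (msupport Q : set (borel T)).
move=> [S [cS mS QS]] mA.
apply: (measure_negligible (measurableC mA)).
have QSC : Q (~` S) = 0%E by rewrite probability_setC// QS subee.
have : ~` A `<=` (S `\` A) `|` ~` S.
  by move=> x nAx; have [Sx|nSx] := pselect (S x); [left|right].
move/negligibleS; apply; apply: negligibleU; last first.
  by apply/negligibleP => //; exact: measurableC.
apply: negligible_countable => [|x [Sx nQx]].
  by apply: sub_countable cS; apply: subset_card_le => x [].
have /existsNP[U /not_implyP[oU /not_implyP[Ux /negP]]] := nQx.
rewrite -leNgt => QU0; exists U; split.
- exact: sub_sigma_algebra.
- by apply/eqP; rewrite eq_le QU0 measure_ge0.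
- by move=> _ ->.
Qed.

(** * Borel sets of a Euclidean space and of its subspaces *)

Section subspace.
Context (R : realType) (n : nat).

Lemma closed_rV1 (x : 'rV[R]_n) : closed [set x].
Proof.
have -> : [set x] =
    \bigcap_(i in [set: 'I_n]) ((fun y : 'rV[R]_n => y ord0 i) @^-1`
      [set x ord0 i]).
  rewrite eqEsubset; split => [_ -> //|y xy].
  by apply/rowP => i; exact: xy.
apply: closed_bigI => i _; apply: preimage_closed => [y _|].
  exact: coord_continuous.
exact/accessible_closed_set1/hausdorff_accessible/Rhausdorff.
Qed.

Lemma measurable_rV1 (x : borel 'rV[R]_n) : measurable [set x].
Proof.
rewrite -[X in measurable X]setCK; apply: measurableC.
by apply: sub_sigma_algebra; rewrite openC; exact: closed_rV1.
Qed.

Lemma measurable_subvs1 (H : {vspace 'rV[R]_n}) (u : borel (subvs_of H)) :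
  measurable [set u].
Proof.
rewrite -[X in measurable X]setCK; apply: measurableC.
apply: sub_sigma_algebra; exists (~` [set vsval u]).
  by rewrite openC; exact: closed_rV1.
by apply/seteqP; split => v; apply: contra_not; [move=> ->|move=> /val_inj].
Qed.

Lemma orthproj_eq_ortho (H : {vspace 'rV[R]_n}) (x y : 'rV[R]_n) :
  orthproj H x = orthproj H y -> x - y \in orthocompl H.
Proof.
move=> xy; have := memvB (orthproj_ortho H x) (orthproj_ortho H y).
by rewrite xy opprB addrA subrK.
Qed.

End subspace.

(** * The inequality *)

Theorem theorem2p1 (R : realType) (d k : nat) (d_gt0 : (0 < d)%N)
  (k_gt0 : (0 < k)%N) (Q : probability (borel 'rV[R]_d) R)
  (Q_discrete : discrete_probability Q) (Q_supp : (msupport Q #<= `I_k)%card)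
  (H : 'I_k.+1 -> {vspace 'rV[R]_d})
  (H_cap : forall i j : 'I_k.+1, i != j ->
     (orthocompl (H i) :&: orthocompl (H j) = 0)%VS)
  (P : probability (borel 'rV[R]_d) R) :
  (dTV P Q <= \sum_(j < k.+1) dTV (projection (H j) P) (projection (H j) Q))%E.
Proof.
set A := (msupport Q : set (borel 'rV[R]_d)).
have finA : finite_set A by apply/finite_set_leP; exists k.
have mA : measurable A.
  exact: countable_measurable (@measurable_rV1 _ _) (finite_set_countable finA).
have QA : Q (~` A) = 0%E by exact: msupport_full.
have sep z : exists j, forall x, A x ->
    orthproj (H j) x = orthproj (H j) z -> x = z.
  have [|j jP] := @separating_index k _ _ (fun j => orthproj (H j))
      (finmap.enum_fset (fset_set A)) (geq_card_fset_set Q_supp) _ z.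
    move=> i j x y ij /orthproj_eq_ortho xyi /orthproj_eq_ortho xyj.
    apply/eqP; rewrite -subr_eq0 -memv0 -(H_cap i j ij) memv_cap.
    by rewrite xyi xyj.
  by exists j => x Ax; apply: jP; rewrite in_fset_set// inE.
apply: dTV_le => G mG.
have [V [finV GV VG tV]] := exists_cylinder_cover G finA sep.
pose F j : set (borel 'rV[R]_d) := orthproj (H j) @^-1` V j.
have mV j : measurable (V j : set (borel (subvs_of (H j)))).
  rewrite -[X in measurable X]setCK; apply: measurableC.
  apply: countable_measurable (finite_set_countable (finV j)).
  exact: measurable_subvs1.
have mF j : measurable (F j).
  by rewrite -[F j]setTI; exact: measurable_orthproj.
have PF : (P G <= \sum_(j < k.+1) P (F j))%E.
  rewrite (eq_bigr (fun j : 'I_k.+1 => P (F (inord j)))); last first.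
    by move=> j _; rewrite inord_val.
  have cover : G `<=` \big[setU/set0]_(j < k.+1) F (inord j).
    rewrite -(bigcup_mkord k.+1 (fun j => F (inord j))) => z /GV[j _ Fz].
    by exists j => //=; rewrite inord_val.
  exact: (@content_subadditive _ _ _ P _ (fun j => F (inord j)) _ _ mG cover).
have QF : (\sum_(j < k.+1) Q (F j) <= Q G)%E.
  have QFA j : Q (F j) = Q (A `&` F j).
    have sub : F j `\` A `<=` ~` A by move=> x [].
    have Q0 := subset_measure0 (measurableD (mF j) mA) (measurableC mA) sub QA.
    by rewrite (measureDI Q (mF j) mA) setIC [X in (X + _)%E]Q0 add0e.
  under eq_bigr do rewrite QFA.
  rewrite -(@measure_bigsetU_ord _ _ _ _ _ xpredT) => [|j|//]; last first.
    exact: measurableI.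
  apply: le_measure; rewrite ?inE//.
    by apply: bigsetU_measurable => j _; exact: measurableI.
  by rewrite -bigcup_mkord_ord => x [j _] /VG.
rewrite leeBlDr ?fin_num_measure//; apply: le_trans PF _.
apply: le_trans (leeD2l _ QF); rewrite -big_split; apply: lee_sum => j _ /=.
rewrite -leeBlDr ?fin_num_measure//.
exact: (probability_sub_le_dTV (projection (H j) P) (projection (H j) Q)).
Qed.
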